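(* Consider the joint association and relaying problem (P) described in the context, and suppose the binary association variables $\mathbf x$ are fixed and feasible. Then the optimal rate vector $\mathbf r^*$ for problem (P) with association $\mathbf x$ is given by: (a) $r_i^* = \hat c^{\eta}_{ik}$ if $x_{ik}=1$, for all $i\in\mathcal C_-$, $k\in\mathcal A$; (b) $r_j^* = \hat c^{\eta}_{jk}$ if $\sum_{i\in\mathcal C_-}x_{ij}=0$ and $x_{jk}=1$, for all $j\in\mathcal C_+$, $k\in\mathcal A$; (c) $r_i^* = \min\left(\hat c^{\eta}_{ij},\ \hat c^{\eta}_{jk}/2\right)$ and $r_j^* = \hat c^{\eta}_{jk}-r_i^*$ if $x_{ij}x_{jk}=1$, for all $i\in\mathcal C_-$, $j\in\mathcal C_+$, $k\in\mathcal A$.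
   Context: $\mathcal A$ is a finite set of access points (APs), $\mathcal C$ a finite set of clients, $\mathcal C_+\subseteq\mathcal C$ the subset of relays (clients with relaying capability), and $\mathcal C_-=\mathcal C\setminus\mathcal C_+$. For each link $(a,b)$ (client–relay $(i,j)$, client–AP $(i,k)$, relay–AP $(j,k)$) the achievable rate is a random variable $c_{ab}=\log_2(1+\mathrm{SNR}_{ab})$, whose conditional distribution given an estimate $\widetilde{\mathrm{SNR}}_{ab}$ is known. Fix a design parameter $\eta\in(0,1)$. For each link, $\hat c^{\eta}_{ab}$ denotes the (unique) threshold with $\Pr(c_{ab}\le \hat c^{\eta}_{ab}\mid \widetilde{\mathrm{SNR}}_{ab})=\eta$. Problem (P): the variables are $\mathbf x=(x_{ij},x_{ik},x_{jk})$ (association indicators), $\mathbf r=(r_i)_{i\in\mathcal C}$ (real rates), $\mathbf y=(y_{ik})_{i\in\mathcal C,k\in\mathcal A}$ (resource fractions). Maximize $$\sum_{i\in\mathcal C}\sum_{k\in\mathcal A}x_{ik}\log(r_iy_{ik})+\sum_{i\in\mathcal C_-}\sum_{j\in\mathcal C_+}\sum_{k\in\mathcal A}x_{ij}x_{jk}\log(r_iy_{ik})$$ (a term with coefficient $0$ counts as $0$; a term with nonzero coefficient requires $r_iy_{ik}>0$) subject to, for all $i\in\mathcal C_-$, $j\in\mathcal C_+$, $k\in\mathcal A$: - $\Pr(r_ix_{ij}\ge c_{ij}\mid\widetilde{\mathrm{SNR}}_{ij})\le\eta$ and $\Pr(r_ix_{ik}\ge c_{ik}\mid\widetilde{\mathrm{SNR}}_{ik})\le\eta$;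 - $\Pr\left(\left(\sum_{i\in\mathcal C_-}r_ix_{ij}+r_j\right)x_{jk}\ge c_{jk}\,\middle|\,\widetilde{\mathrm{SNR}}_{jk}\right)\le\eta$; - $\sum_{j\in\mathcal C_+}x_{ij}+\sum_{k\in\mathcal A}x_{ik}=1$; - $\sum_{i\in\mathcal C_-}x_{ij}\le1$ and $\sum_{k\in\mathcal A}x_{jk}=1$; - $(y_{ik}-y_{jk})x_{ij}=0$; - $x_{ij},x_{ik},x_{jk}\in\{0,1\}$; - $\sum_{i\in\mathcal C}x_{ik}y_{ik}\le1$ for all $k\in\mathcal A$, and $y_{ik}\ge0$ for all $i\in\mathcal C$, $k\in\mathcal A$. ''$\mathbf x$ fixed and feasible'' means that $\mathbf x$ is held fixed and there exist $\mathbf r,\mathbf y$ such that all constraints hold and the objective is well defined; the optimization is then over $\mathbf r,\mathbf y$ only. *)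

(* Defs.v *)
From HB Require Import structures.
From mathcomp Require Import all_boot all_order all_algebra.
From mathcomp Require Import all_classical all_reals all_analysis.

Set Implicit Arguments.
Unset Strict Implicit.
Unset Printing Implicit Defensive.

Import Order.TTheory GRing.Theory Num.Theory.
Import numFieldNormedType.Exports.

Local Open Scope classical_set_scope.
Local Open Scope ring_scope.

(* log_2 (1 + SNR), with the SNR on a linear (not dB) scale *)
Definition rate (R : realType) (snr : R) : R := ln (1 + snr) / ln 2.

(* [cond_law] is a regular conditional distribution of the achievable rate given
   the estimate [snr_est]; [est_val] is the value of the estimate on which the
   optimization is conditioned. *)
Record link_model (d : measure_display) (Omega : measurableType d)
    (R : realType) (P : probability Omega R) := LinkModel {
  snr : {RV P >-> R};
  snr_ge0 : forall w, 0 <= snr w;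
  snr_est : {RV P >-> R};
  cond_law : R.-pker (measurableTypeR R) ~> (measurableTypeR R);
  cond_lawP : forall A B : set (measurableTypeR R),
    measurable A -> measurable B ->
    P (snr_est @^-1` A `&` (fun w => rate (snr w)) @^-1` B) =
    (\int[distribution P snr_est]_(s in A) cond_law s B)%E;
  est_val : R
}.

(* Pr (t >= c | estimate) *)
Definition outage (d : measure_display) (Omega : measurableType d)
    (R : realType) (P : probability Omega R) (l : link_model P) (t : R) : \bar R :=
  cond_law l (est_val l) [set c : R | t >= c].

Definition is_threshold (d : measure_display) (Omega : measurableType d)
    (R : realType) (P : probability Omega R) (l : link_model P) (eta chat : R) :=
  forall t : R, outage l t = eta%:E <-> t = chat.

(* A link runs from a client to a receiver in [C + A]: [inl j] is the relay j and
   [inr k] the access point k.  Families indexed by [C -> C + A -> _] are total;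
   only their values at links are ever used. *)
Definition is_link (C A : finType) (relays : {set C}) (a : C) (b : C + A) : bool :=
  match b with
  | inl j => (a \in ~: relays) && (j \in relays)
  | inr _ => true
  end.

Section Problem.
Variables (d : measure_display) (Omega : measurableType d).
Variables (R : realType) (P : probability Omega R).
Variables (C A : finType) (relays : {set C}).
Variables (L : C -> C + A -> link_model P) (eta : R).
Variables (x : C -> C + A -> R) (r : C -> R) (y : C -> A -> R).

Record constraints : Prop := Constraints {
  chance_client_relay : forall i j, i \in ~: relays -> j \in relays ->
    (outage (L i (inl j)) (r i * x i (inl j)) <= eta%:E)%E;
  chance_client_AP : forall i k, i \in ~: relays ->
    (outage (L i (inr k)) (r i * x i (inr k)) <= eta%:E)%E;
  chance_relay_AP : forall j k, j \in relays ->
    (outage (L j (inr k))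
      (((\sum_(i in ~: relays) r i * x i (inl j)) + r j) * x j (inr k))
     <= eta%:E)%E;
  client_assoc : forall i, i \in ~: relays ->
    \sum_(j in relays) x i (inl j) + \sum_(k : A) x i (inr k) = 1;
  relay_load : forall j, j \in relays ->
    \sum_(i in ~: relays) x i (inl j) <= 1;
  relay_assoc : forall j, j \in relays -> \sum_(k : A) x j (inr k) = 1;
  resource_sharing : forall i j k, i \in ~: relays -> j \in relays ->
    (y i k - y j k) * x i (inl j) = 0;
  binary : forall a b, is_link relays a b -> x a b = 0 \/ x a b = 1;
  resource_budget : forall k, \sum_(i : C) x i (inr k) * y i k <= 1;
  resource_ge0 : forall i k, 0 <= y i k
}.

Definition well_defined : Prop :=
  (forall i k, x i (inr k) != 0 -> 0 < r i * y i k) /\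
  (forall i j k, i \in ~: relays -> j \in relays ->
     x i (inl j) * x j (inr k) != 0 -> 0 < r i * y i k).

Definition objective : R :=
  \sum_(i : C) \sum_(k : A) x i (inr k) * ln (r i * y i k) +
  \sum_(i in ~: relays) \sum_(j in relays) \sum_(k : A)
     x i (inl j) * x j (inr k) * ln (r i * y i k).

Definition admissible : Prop := constraints /\ well_defined.

End Problem.

Definition optimal (d : measure_display) (Omega : measurableType d)
    (R : realType) (P : probability Omega R) (C A : finType) (relays : {set C})
    (L : C -> C + A -> link_model P) (eta : R)
    (x : C -> C + A -> R) (r : C -> R) (y : C -> A -> R) : Prop :=
  admissible relays L eta x r y /\
  forall r' y', admissible relays L eta x r' y' ->
    objective relays x r' y' <= objective relays x r y.

(* Main.v *)
Require Import Defs.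
From HB Require Import structures.
From mathcomp Require Import all_boot all_order all_algebra.
From mathcomp Require Import all_classical all_reals all_analysis.
From mathcomp Require Import ring lra.

Set Implicit Arguments.
Unset Strict Implicit.
Unset Printing Implicit Defensive.

Import Order.TTheory GRing.Theory Num.Theory.

Local Open Scope ring_scope.

(** Each client contributes exactly one term [ln (r i * y i k)], with [k] the AP
    it finally reaches, so for fixed [x] the objective splits into
    [\sum_i ln (r i)] and [\sum_i ln (y i k)], whose constraints are unrelated.
    For each part there is an explicit candidate [z] with
    [\sum_i (w i / z i - 1) <= 0] for every feasible [w]; the inequality
    [ln t <= t - 1], strict for [t != 1], makes [z] a maximizer, and gives
    uniqueness of the rates.
    For the shares, [z] gives every directly attached client a part of its AP
    proportional to the number of clients it carries (one or two). *)

(** * Logarithmic inequalities and sums of indicators *)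

Lemma ln_le_subr1 (R : realType) (t : R) : 0 < t -> ln t <= t - 1 ?= iff (t == 1).
Proof.
move=> t0; have [->|t1] := eqVneq t 1; first by rewrite ln1 subrr; exact/leif_refl.
have lnt : ln t != 0 by rewrite ln_eq0.
have lt : ln t < t - 1.
  by have := expR_gt1Dx lnt; rewrite lnK ?posrE// ltrBrDl.
by split; [exact: ltW | rewrite lt_eqF].
Qed.

(** The tangent to the strictly concave [ln] at [b] lies above its graph and touches it only
    there. *)
Lemma ln_le_ratio (R : realType) (a b : R) : 0 < a -> 0 < b ->
  ln a <= ln b + (a / b - 1) ?= iff (a == b).
Proof.
move=> a0 b0; have [le eq] := ln_le_subr1 (divr_gt0 a0 b0).
have b1 : b != 0 by rewrite gt_eqF.
have -> : ln a = ln b + ln (a / b) by rewrite ln_div ?posrE// addrC subrK.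
split; first by rewrite lerD2l.
by rewrite (inj_eq (addrI _)) eq -(inj_eq (mulIf b1)) mul1r divfK.
Qed.

Lemma sum_ln_ratio (R : realType) (I : finType) (a b : I -> R) :
  (forall i, 0 < a i) -> (forall i, 0 < b i) ->
  \sum_i (a i / b i - 1) <= 0 ->
  \sum_i ln (a i) <= \sum_i ln (b i) ?= iff [forall i, a i == b i].
Proof.
move=> a0 b0 ab.
have [] : \sum_i ln (a i) <= \sum_i (ln (b i) + (a i / b i - 1))
    ?= iff [forall i, a i == b i].
  by apply: leif_sum => i _; exact: ln_le_ratio.
rewrite big_split/= => le eq.
split; first by apply: le_trans le _; rewrite gerDl.
apply/eqP/forallP => [E|E]; last by apply: eq_bigr => i _; rewrite (eqP (E i)).
apply/forallP; rewrite -eq eq_le le/= E gerDl//.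
Qed.

(** Once one indicator is [1], the others are nonnegative with sum [0], hence vanish. This turns
    association indicators into a choice of receiver. *)
Lemma binary_sum_eq1 (R : numDomainType) (I : finType) (Q : pred I) (F : I -> R) :
  (forall i, Q i -> F i = 0 \/ F i = 1) -> \sum_(i | Q i) F i = 1 ->
  exists2 i0, Q i0 & forall i, Q i -> F i = (i0 == i)%:R.
Proof.
move=> F01 sum1.
have F0 i : Q i -> 0 <= F i by move=> /F01[]->.
have [i0 /andP[Qi0 /eqP Fi0]|none] := pickP [pred i | Q i && (F i == 1)]; last first.
  move: sum1; rewrite big1 => [/eqP|i Qi]; first by rewrite eq_sym oner_eq0.
  by have [//|Fi] := F01 _ Qi; have := none i; rewrite /= Qi Fi eqxx.
exists i0 => // i Qi; have [<-//|ne] := eqVneq i0 i.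
move: sum1; rewrite (bigD1 i0)//= Fi0 => /eqP; rewrite -subr_eq0 addrAC subrr add0r.
move/eqP/psumr_eq0P => -> //; last by rewrite Qi eq_sym.
by move=> j /andP[/F0].
Qed.

(** * Optimal rates within a group sharing one AP link *)

Section Rates.
Variables (R : realType) (C : finType) (anchor : C -> C) (lim cap : C -> R).
Hypothesis anchorK : forall i, anchor (anchor i) = anchor i.
Hypothesis anchor_inj : forall i i',
  anchor i != i -> anchor i' != i' -> anchor i = anchor i' -> i = i'.

(* The group of a fixed point [u] of [anchor] is [u] together with the at most
   one client that [u] relays; [cap u] bounds the load of the group on the link
   from [u] to its AP, [lim i] the rate of a relayed client [i] on its link to
   [anchor i]. *)
Record rate_feasible (r : C -> R) : Prop := RateFeasible {
  rate_gt0 : forall i, 0 < r i;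
  rate_le_lim : forall i, anchor i != i -> r i <= lim i;
  rate_le_cap : forall u, anchor u = u -> \sum_(i | anchor i == u) r i <= cap u
}.

(** The product of two rates with a bounded total is largest at equal halves; a tighter limit on the
    relayed client binds instead. *)
Definition relayed_rate i := Num.min (lim i) (cap (anchor i) / 2).

(** By [anchor_inj] the sum has at most one term, so this form covers a fixed point with or without
    a relayed client. *)
Definition best_rate i :=
  if anchor i == i
  then cap i - \sum_(m | (anchor m == i) && (m != i)) relayed_rate m
  else relayed_rate i.

Lemma anchored_sum u (F : C -> R) : anchor u = u ->
  \sum_(i | anchor i == u) F i =
  F u + \sum_(i | (anchor i == u) && (i != u)) F i.
Proof. by move=> uu; rewrite (bigD1 u) ?uu. Qed.

(** [m] is found before [F], so one case split evaluates several such sums. *)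
Lemma relayed_sum u :
  (forall F : C -> R, \sum_(i | (anchor i == u) && (i != u)) F i = 0) \/
  exists m, [/\ anchor m = u, m != u &
    forall F : C -> R, \sum_(i | (anchor i == u) && (i != u)) F i = F m].
Proof.
have [m /andP[/eqP mu mnu]|none] := pickP [pred i | (anchor i == u) && (i != u)].
  right; exists m; split=> // F; rewrite (big_pred1 m)// => i.
  apply/andP/eqP => [[/eqP iu inu]|->]; last by rewrite mu.
  by apply: anchor_inj; rewrite ?iu ?mu 1?eq_sym.
by left=> F; rewrite big_pred0.
Qed.

(** The given [r] forces positive capacities and limits; a fixed point serving a client keeps at
    least half of its capacity. *)
Lemma best_rate_feasible r : rate_feasible r -> rate_feasible best_rate.
Proof.
move=> [r0 rlim rcap].
have cap0 u : anchor u = u -> 0 < cap u.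
  move=> uu; apply: lt_le_trans (rcap _ uu); rewrite anchored_sum//.
  by rewrite ltr_wpDr// sumr_ge0// => i _; exact/ltW.
have relayed0 i : anchor i != i -> 0 < relayed_rate i.
  move=> ai; rewrite lt_min divr_gt0 ?cap0//= andbT.
  exact: lt_le_trans (rlim _ ai).
split=> [i|i ai|u uu].
- rewrite /best_rate; case: eqP => [ii|/eqP/relayed0//].
  have [->|[m [mi mni ->]]] := relayed_sum i; first by rewrite subr0 cap0.
  have := cap0 _ ii; rewrite /relayed_rate mi => c0.
  have half : cap i / 2 < cap i by lra.
  by rewrite subr_gt0 (le_lt_trans _ half)// ge_min lexx orbT.
- by rewrite /best_rate (negbTE ai) ge_min lexx.
- rewrite anchored_sum// {1}/best_rate uu eqxx.
  rewrite [X in _ + X](eq_bigr relayed_rate) ?subrK// => i /andP[/eqP iu inu].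
  by rewrite /best_rate iu eq_sym (negbTE inu).
Qed.

(** The inequality holds group by group: a lone fixed point needs only its capacity bound, a pair
    also the limit of the relayed client when that limit binds. *)
Lemma best_rate_ratio r : rate_feasible r ->
  \sum_i (r i / best_rate i - 1) <= 0.
Proof.
move=> rf; have [b0 _ _] := best_rate_feasible rf; have [r0 rlim rcap] := rf.
rewrite (partition_big anchor (fun u => anchor u == u))/=; last first.
  by move=> i _; rewrite anchorK.
apply: sumr_le0 => u /eqP uu; have := rcap _ uu; rewrite !anchored_sum//.
have bu : best_rate u =
    cap u - \sum_(m | (anchor m == u) && (m != u)) relayed_rate m.
  by rewrite /best_rate uu eqxx.
have := b0 u; rewrite bu.
have [S|[m [mu mnu S]]] := relayed_sum u; rewrite !S.
  by rewrite subr0 !addr0 => c0 rc; rewrite subr_le0 ler_pdivrMr ?mul1r.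
have an_m : anchor m != m by rewrite mu eq_sym.
have bm : best_rate m = relayed_rate m by rewrite /best_rate (negbTE an_m).
have := b0 m; have := rlim m an_m; rewrite bm /relayed_rate mu.
have := r0 u; have := r0 m.
set q := r m; set p := r u; set c := cap u; set l := lim m.
move=> q0 p0 ql; case: (leP l (c / 2)) => h a0 b0' pq.
- rewrite -subr_ge0.
  (* Over the denominator [l * (c - l)], the slacks of capacity and limit appear with multipliers
     [l] and [c - 2 * l], nonnegative because [l <= c / 2]. *)
  have -> : 0 - (p / (c - l) - 1 + (q / l - 1)) =
    (l * (c - p - q) + (l - q) * (c - 2 * l)) / (l * (c - l)).
    by field; rewrite !gt_eqF.
  apply: divr_ge0; last by rewrite mulr_ge0// ltW.
  by rewrite addr_ge0// mulr_ge0//; [exact/ltW|lra..].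
- have -> : c - c / 2 = c / 2 by lra.
  have -> : p / (c / 2) - 1 + (q / (c / 2) - 1) = (p + q) / (c / 2) - 2 by ring.
  by rewrite subr_le0 ler_pdivrMr//; lra.
Qed.

End Rates.

(** * Optimal resource shares at each AP *)

Section Shares.
Variables (R : realType) (C A : finType) (anchor : C -> C) (ap : C -> A).
Hypothesis anchorK : forall i, anchor (anchor i) = anchor i.
Hypothesis ap_anchor : forall i, ap (anchor i) = ap i.

(** Only directly attached clients consume the budget of an AP; a relayed client reuses the share of
    its relay. *)
Record share_feasible (y : C -> A -> R) : Prop := ShareFeasible {
  share_gt0 : forall i, 0 < y i (ap i);
  share_ge0 : forall i k, 0 <= y i k;
  share_anchor : forall i k, y i k = y (anchor i) k;
  share_budget : forall k, \sum_(u | (anchor u == u) && (ap u == k)) y u k <= 1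
}.

Definition weight u : R := #|[pred m | anchor m == u]|%:R.
Definition ap_load k : R := #|[pred m | ap m == k]|%:R.

(* An AP reached by no client has load [0] and its shares are [_ / 0 = 0]. *)
Definition best_share i k := weight (anchor i) / ap_load k.

Lemma weight_anchor_gt0 i : 0 < weight (anchor i).
Proof. by rewrite ltr0n; apply/card_gt0P; exists i; rewrite inE. Qed.

Lemma ap_load_gt0 i : 0 < ap_load (ap i).
Proof. by rewrite ltr0n; apply/card_gt0P; exists i; rewrite inE. Qed.

(** [ap_anchor] keeps each group within one AP, so the clients of [k] are its fixed points counted
    with multiplicity. *)
Lemma sum_by_anchor k (F : C -> R) :
  \sum_(m | ap m == k) F (anchor m) =
  \sum_(u | (anchor u == u) && (ap u == k)) weight u * F u.
Proof.
rewrite (partition_big anchor (fun u => (anchor u == u) && (ap u == k)))/=; last first.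
  by move=> i /eqP ik; rewrite anchorK ap_anchor ik !eqxx.
apply: eq_bigr => u /andP[_ /eqP uk].
rewrite (eq_bigl (fun m => m \in [pred m | anchor m == u])) => [|m]; last first.
  rewrite inE; case: (anchor m =P u) => [mu|_]; last by rewrite andbF.
  by rewrite -ap_anchor mu uk eqxx.
rewrite (eq_bigr (fun=> F u)) => [|m]; last by rewrite inE => /eqP ->.
by rewrite sumr_const mulr_natl.
Qed.

Lemma best_share_feasible : share_feasible best_share.
Proof.
split=> [i|i k|i k|k].
- by rewrite divr_gt0 ?weight_anchor_gt0 ?ap_load_gt0.
- by rewrite divr_ge0 ?ler0n.
- by rewrite /best_share anchorK.
- rewrite (eq_bigr (fun u => weight u * (ap_load k)^-1)) => [|u /andP[/eqP uu _]].
    rewrite -(sum_by_anchor k (fun=> (ap_load k)^-1)).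
    rewrite (eq_bigl (fun m => m \in [pred m | ap m == k]))// sumr_const.
    rewrite -mulr_natl -/(ap_load k).
    (* The sum is now [ap_load k / ap_load k], which is [0] rather than [1] at an AP that no client
       reaches. *)
    have [->|l0] := eqVneq (ap_load k) 0; first by rewrite mul0r.
    by rewrite divff.
  by rewrite /best_share uu.
Qed.

(** At AP [k] the weights cancel after grouping by anchor, leaving [ap_load k] times the budget sum,
    minus [ap_load k]. *)
Lemma best_share_ratio y : share_feasible y ->
  \sum_i (y i (ap i) / best_share i (ap i) - 1) <= 0.
Proof.
move=> [y0 _ yan bud]; rewrite (partition_big ap xpredT)//=.
apply: sumr_le0 => k _.
rewrite (eq_bigr (fun i =>
    y (anchor i) k / weight (anchor i) * ap_load k - 1)) => [|i /eqP <-]; last first.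
  by rewrite /best_share -yan invf_div mulrA mulrAC.
rewrite sumrB -mulr_suml (sum_by_anchor k (fun u => y u k / weight u)).
rewrite [X in _ - X](eq_bigl (fun m => m \in [pred m | ap m == k]))// sumr_const.
rewrite -/(ap_load k) subr_le0.
rewrite (eq_bigr (fun u => y u k)) => [|u /andP[/eqP uu _]].
  by rewrite ler_piMl ?ler0n.
by rewrite mulrC divfK// -uu gt_eqF ?weight_anchor_gt0.
Qed.

End Shares.

(** * Chance constraints as linear bounds *)

Section Thresholds.
Variables (d : measure_display) (Omega : measurableType d) (R : realType).
Variables (P : probability Omega R) (l : link_model P).

Lemma le_outage (s t : R) : s <= t -> (outage l s <= outage l t)%E.
Proof.
move=> st; have m (u : R) :
    measurable ([set c | u >= c]%classic : set (measurableTypeR R)).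
  have -> : [set c | u >= c]%classic = `]-oo, u]%classic by rewrite set_itvE.
  exact: measurable_itv.
apply: le_measure; rewrite ?inE; [exact: m|exact: m|].
by move=> c /= cs; exact: le_trans st.
Qed.

(** One direction is monotonicity. Conversely, a [t] above [chat] with outage at most [eta] would
    have outage exactly [eta], against uniqueness of the threshold. *)
Lemma outage_le_threshold (eta chat t : R) : is_threshold l eta chat ->
  (outage l t <= eta%:E)%E = (t <= chat).
Proof.
move=> th; have out_chat : outage l chat = eta%:E by apply/th.
apply/idP/idP => [le|le]; last by rewrite -out_chat le_outage.
rewrite leNgt; apply/negP => lt; suff : t = chat by move=> E; rewrite E ltxx in lt.
by apply/th/eqP; rewrite eq_le le -out_chat le_outage// ltW.
Qed.

End Thresholds.

(** * Binary associations as routing functions *)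

Section Association.
Variables (R : realType) (A C : finType) (relays : {set C}).

(* [anchor i] is the relay serving [i], or [i] itself if [i] is attached to an AP
   directly; [ap i] is the AP that [i] eventually reaches. *)
Definition route (anchor : C -> C) (ap : C -> A) (i : C) : C + A :=
  if anchor i == i then inr (ap i) else inl (anchor i).

(** [anchor_inj] encodes the relay load bound: two relayed clients never share a relay. *)
Record association (x : C -> C + A -> R) (anchor : C -> C) (ap : C -> A) : Prop :=
  Association {
  route_link : forall i, is_link relays i (route anchor ap i);
  routeE : forall i b, is_link relays i b -> x i b = (route anchor ap i == b)%:R;
  ap_anchor : forall i, ap (anchor i) = ap i;
  anchor_inj : forall i i',
    anchor i != i -> anchor i' != i' -> anchor i = anchor i' -> i = i'
}.

Lemma admissible_association (d : measure_display) (Omega : measurableType d)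
    (P : probability Omega R) (L : C -> C + A -> link_model P) (eta : R)
    (x : C -> C + A -> R) (r : C -> R) (y : C -> A -> R) :
  admissible relays L eta x r y -> exists anchor ap, association x anchor ap.
Proof.
move=> [[_ _ _ client load relay _ bin _ _] _].
have recv_ex i : exists b0, is_link relays i b0 /\
    forall b, is_link relays i b -> x i b = (b0 == b)%:R.
  (* The association constraints of relays and non-relays merge: every client has exactly one
     outgoing link. *)
  have sum1 : \sum_(b : C + A | is_link relays i b) x i b = 1.
    rewrite big_sumType/=; have [ir|ir] := boolP (i \in relays).
      by rewrite big_pred0 ?add0r ?relay// => j; rewrite inE ir.
    rewrite -[RHS](client i) ?inE//; congr (_ + _).
    by apply: eq_bigl => j; rewrite ir.
  by have [b0 ? ?] := binary_sum_eq1 (bin i) sum1; exists b0.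
have [recv recvP] := choice recv_ex.
have recv_relay j : j \in relays -> exists k, recv j = inr k.
  move=> jr; have [] := recvP j; case: (recv j) => [j' /=|k]; last by exists k.
  by rewrite inE jr.
(* [p] is the anchor of [i] with the final AP; a relay sends only to an AP, so a route has at most
   two hops. *)
have spec i : exists p : C * A, [/\ recv p.1 = inr p.2,
    recv i = (if p.1 == i then inr p.2 else inl p.1) &
    p.1 == i \/ (i \notin relays) && (p.1 \in relays)].
  have [] := recvP i; case Ei: (recv i) => [j|k] /= lnk _; last first.
    by exists (i, k); split=> /=; rewrite ?eqxx//; left.
  move: lnk; rewrite inE => /andP[ir jr]; have [k Ej] := recv_relay _ jr.
  exists (j, k); split=> //=; last by right; rewrite ir.
  by case: eqP => // ji; rewrite ji (negbTE ir) in jr.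
have [p pP] := choice spec.
have anchor_recv i : recv (p i).1 = inr (p i).2 by have [] := pP i.
have recvE i : recv i = route (fun i => (p i).1) (fun i => (p i).2) i.
  by have [] := pP i.
have anchored i : (p i).1 != i -> (i \notin relays) && ((p i).1 \in relays).
  by have [_ _ []] := pP i => [->|].
exists (fun i => (p i).1), (fun i => (p i).2); split=> [i|i b|i|i i' ii ii' E].
- by rewrite -recvE; have [] := recvP i.
- by rewrite -recvE; have [_ ] := recvP i; apply.
- have := recvE (p i).1; rewrite anchor_recv /route; case: eqP => // _ [].
  by move=> ->.
- have /andP[ir jr] := anchored _ ii; have /andP[ir' _] := anchored _ ii'.
  (* Two distinct clients on one relay would load it with at least [2]. *)
  apply/eqP/negPn/negP => ne; have := load _ jr.
  have x1 m : m \notin relays -> (p m).1 != m -> (p m).1 = (p i).1 ->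
      x m (inl (p i).1) = 1.
    move=> mr mm me; have [_ xE] := recvP m.
    by rewrite xE /= ?inE ?mr// recvE /route (negbTE mm) me eqxx.
  rewrite (bigD1 i) ?inE// (bigD1 i') ?inE ?ir' 1?eq_sym//= !x1//.
  set S := (X in _ + (_ + X)); suff : 0 <= S by lra.
  apply: sumr_ge0 => m /andP[/andP[mr _] _].
  have ml : is_link relays m (inl (p i).1 : C + A) by rewrite /= mr.
  by case: (bin _ _ ml) => ->.
Qed.

(** * Equivalence of admissibility with the separate rate and share problems *)

Section Fixed.
Variables (x : C -> C + A -> R) (anchor : C -> C) (ap : C -> A).
Hypothesis asc : association x anchor ap.

Lemma anchored_link i : anchor i != i -> (i \notin relays) && (anchor i \in relays).
Proof.
by move=> ii; have := route_link asc i; rewrite /route (negbTE ii) /= inE.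
Qed.

Lemma anchor_relay j : j \in relays -> anchor j = j.
Proof. by move=> jr; apply/eqP; apply: contraLR jr => /anchored_link/andP[]. Qed.

Lemma anchorK i : anchor (anchor i) = anchor i.
Proof.
have [ii|/anchored_link/andP[_ /anchor_relay//]] := eqVneq (anchor i) i.
by rewrite !ii.
Qed.

(** Only relays anchor other clients, so the group of a directly attached non-relay is a
    singleton. *)
Lemma anchored_nonrelay u i : u \notin relays -> anchor u = u ->
  (anchor i == u) = (i == u).
Proof.
move=> ur uu; apply/eqP/eqP => [iu|-> //].
have [<-//|/anchored_link/andP[_]] := eqVneq (anchor i) i.
by rewrite iu (negbTE ur).
Qed.

Lemma x_AP i k : x i (inr k) = ((anchor i == i) && (ap i == k))%:R.
Proof. by rewrite (routeE asc)// /route; case: (anchor i == i). Qed.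

Lemma x_relay i j : i \in ~: relays -> j \in relays ->
  x i (inl j) = (anchor i == j)%:R.
Proof.
move=> ir jr; rewrite (routeE asc)/= ?ir// /route.
have [ii|//] := eqVneq (anchor i) i.
by rewrite ii (_ : i == j = false)//; apply: contraTF ir => /eqP ->; rewrite inE jr.
Qed.

(** A relay anchors itself, so the load on its AP link is the sum over its group. *)
Lemma anchored_client j (F : C -> R) : j \in relays ->
  \sum_(i in ~: relays) F i * x i (inl j) + F j = \sum_(i | anchor i == j) F i.
Proof.
move=> jr; rewrite addrC anchored_sum ?anchor_relay//; congr (_ + _).
rewrite big_mkcond [RHS]big_mkcond; apply: eq_bigr => i _.
have [ir|] := boolP (i \in ~: relays).
  rewrite x_relay//; have [ij|_] := eqVneq (anchor i) j; last by rewrite mulr0.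
  rewrite mulr1; case: eqP => // eij; by rewrite inE eij jr in ir.
rewrite inE negbK => ir; rewrite anchor_relay//.
by case: eqP.
Qed.

(** One coefficient per client survives: a direct AP link in the first sum or a two-hop route in the
    second. *)
Lemma objectiveE r y :
  objective relays x r y = \sum_i ln (r i * y i (ap i)).
Proof.
rewrite /objective [X in _ + X]big_mkcond -big_split/=; apply: eq_bigr => i _.
under eq_bigr do rewrite x_AP.
have AP_sum u (c : R) : anchor u = u ->
    \sum_k c * x u (inr k) * ln (r i * y i k) = c * ln (r i * y i (ap u)).
  move=> uu; rewrite (bigD1 (ap u))//= x_AP uu !eqxx mulr1 big1 ?addr0// => k ne.
  by rewrite x_AP [ap u == k]eq_sym (negbTE ne) andbF mulr0 mul0r.
have [ii|/[dup] ni /anchored_link/andP[ir jr]] := eqVneq (anchor i) i.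
  have -> : \sum_k (true && (ap i == k))%:R * ln (r i * y i k) =
      ln (r i * y i (ap i)).
    rewrite -[RHS]mul1r -AP_sum//; apply: eq_bigr => k _.
    by rewrite x_AP ii eqxx mul1r.
  case: ifP => [ir|_]; last by rewrite addr0.
  rewrite big1 ?addr0// => j jr; rewrite AP_sum ?anchor_relay//.
  rewrite x_relay// ii; case: eqP => [ij|]; last by rewrite mul0r.
  by rewrite inE ij jr in ir.
rewrite big1 ?add0r => [|k _]; last by rewrite mul0r.
rewrite inE ir (bigD1 (anchor i))//= AP_sum ?anchorK// x_relay ?inE// eqxx.
rewrite mul1r (ap_anchor asc) big1 ?addr0// => j /andP[jr' ne].
by rewrite AP_sum ?(anchor_relay jr')// x_relay ?inE// eq_sym (negbTE ne) mul0r.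
Qed.

Variables (d : measure_display) (Omega : measurableType d).
Variables (P : probability Omega R) (L : C -> C + A -> link_model P).
Variables (eta : R) (chat : C -> C + A -> R).
Hypothesis chatP : forall a b, is_link relays a b ->
  is_threshold (L a b) eta (chat a b).

(** [inl (anchor i)] is a link only for a relayed [i]; [rate_feasible] constrains [lim] only
    there. *)
Let lim i := chat i (inl (anchor i)).
Let cap i := chat i (inr (ap i)).

(** Thresholds are nonnegative at links because they bound nonnegative loads; the converse uses
    this. *)
Lemma admissible_feasible r y : admissible relays L eta x r y ->
  [/\ rate_feasible anchor lim cap r, share_feasible anchor ap y &
      forall a b, is_link relays a b -> 0 <= chat a b].
Proof.
move=> [[cr cA rA _ _ _ share bin budget y_ge0] [wd1 wd2]].
have ry0 i : 0 < r i * y i (ap i).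
  have [ii|/[dup] ni /anchored_link/andP[ir jr]] := eqVneq (anchor i) i.
    by apply: wd1; rewrite x_AP ii !eqxx oner_neq0.
  apply: (wd2 i (anchor i)); rewrite ?inE// x_relay ?inE// x_AP anchorK.
  by rewrite (ap_anchor asc) !eqxx mulr1 oner_neq0.
(* [ry0] alone would allow two negative factors; nonnegative shares exclude this. *)
have y0 i : 0 < y i (ap i).
  rewrite lt_neqAle y_ge0 andbT; apply: contraTneq (ry0 i) => <-.
  by rewrite mulr0 ltxx.
have r0 i : 0 < r i by rewrite -(pmulr_lgt0 _ (y0 i)).
have x0 a b : is_link relays a b -> 0 <= x a b by move=> /bin[]->.
have rA' j k : j \in relays ->
    (\sum_(i | anchor i == j) r i) * x j (inr k) <= chat j (inr k).
  by move=> jr; have := rA j k jr; rewrite (outage_le_threshold _ (chatP _)) ?anchored_client.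
have cr' i j : i \in ~: relays -> j \in relays -> r i * x i (inl j) <= chat i (inl j).
  by move=> ir jr; rewrite -(outage_le_threshold _ (chatP _)) /= ?ir ?jr// cr.
have cA' i k : i \in ~: relays -> r i * x i (inr k) <= chat i (inr k).
  by move=> ir; rewrite -(outage_le_threshold _ (chatP _))// cA.
split.
- split=> // [i ii|u uu].
    have /andP[ir jr] := anchored_link ii.
    by have := cr' i (anchor i); rewrite x_relay ?inE// eqxx mulr1 ir; apply.
  have [ur|ur] := boolP (u \in relays).
    by have := rA' _ (ap u) ur; rewrite x_AP uu !eqxx mulr1.
  rewrite (big_pred1 u) => [|i]; last exact: anchored_nonrelay.
  have := cA' u (ap u); rewrite inE => /(_ ur).
  by rewrite x_AP uu !eqxx mulr1.
- split=> // [i k|k].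
    have [->//|/[dup] ni /anchored_link/andP[ir jr]] := eqVneq (anchor i) i.
    have := share i (anchor i) k; rewrite inE x_relay ?inE// eqxx mulr1.
    by move=> /(_ ir jr)/eqP; rewrite subr_eq0 => /eqP.
  apply: le_trans (budget k); rewrite big_mkcond; apply: ler_sum => i _.
  by rewrite x_AP; case: ifP => _; rewrite ?mul1r ?mul0r.
- move=> a [j /= /andP[ar jr]|k _].
    by apply: le_trans (cr' _ _ ar jr); rewrite mulr_ge0 ?x0//= ?ar// ltW.
  have [ar|ar] := boolP (a \in relays).
    apply: le_trans (rA' _ k ar); rewrite mulr_ge0 ?x0// sumr_ge0// => i _.
    exact: ltW.
  by apply: le_trans (cA' a k _); rewrite ?inE// mulr_ge0 ?x0// ltW.
Qed.

(** At an inactive link the chance constraint reads [0 <= chat]; at an active one it is a bound from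
    [rate_feasible]. *)
Lemma feasible_admissible r y :
  rate_feasible anchor lim cap r -> share_feasible anchor ap y ->
  (forall a b, is_link relays a b -> 0 <= chat a b) ->
  admissible relays L eta x r y.
Proof.
move=> [r0 rlim rcap] [y0 y_ge0 yan bud] chat0.
have assoc1 i : \sum_(b | is_link relays i b) x i b = 1.
  rewrite (bigD1 (route anchor ap i)) ?(route_link asc)//= big1 ?addr0.
    by rewrite (routeE asc) ?eqxx ?(route_link asc).
  by move=> b /andP[ib ne]; rewrite (routeE asc)// eq_sym (negbTE ne).
split; last split.
- split.
  + move=> i j ir jr; rewrite (outage_le_threshold _ (chatP _)) /= ?ir//.
    have ij : is_link relays i (inl j : C + A) by rewrite /= ir.
    rewrite x_relay//; case: eqP => [aij|_]; last by rewrite mulr0 chat0.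
    rewrite mulr1 -aij; apply: rlim; rewrite aij.
    by apply: contraTneq ir => <-; rewrite inE jr.
  + move=> i k ir; rewrite (outage_le_threshold _ (chatP _))// x_AP.
    case: andP => [[/eqP ii /eqP <-]|_]; last by rewrite mulr0 chat0.
    rewrite mulr1; apply: le_trans (rcap _ ii); rewrite (big_pred1 i)// => m.
    by apply: anchored_nonrelay ii; rewrite inE in ir.
  + move=> j k jr; rewrite (outage_le_threshold _ (chatP _))// anchored_client// x_AP.
    rewrite anchor_relay// eqxx; case: eqP => [<-|_]; last by rewrite mulr0 chat0.
    by rewrite mulr1; apply: rcap; rewrite anchor_relay.
  + move=> i ir; rewrite -[RHS](assoc1 i) big_sumType/=; congr (_ + _).
    by apply: eq_bigl => j; rewrite ir.
  + move=> j jr; rewrite -(lerD2r 1).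
    (* The load of [j] is [anchored_client] with constant rates [1]. *)
    under eq_bigr do rewrite -[x _ _]mul1r.
    rewrite (anchored_client (fun=> 1))// anchored_sum ?anchor_relay//.
    by have [->|[m [_ _ ->]]] := relayed_sum R (anchor_inj asc) j; lra.
  + move=> j jr; rewrite -[RHS](assoc1 j) big_sumType/= [X in _ = X + _]big_pred0 ?add0r//.
    by move=> i; rewrite inE jr.
  + move=> i j k ir jr; rewrite x_relay//; case: eqP => [<-|_]; last by rewrite mulr0.
    by rewrite -yan subrr mul0r.
  + by move=> a b ab; rewrite (routeE asc)//; case: eqP; [right|left].
  + move=> k; apply: le_trans (bud k); rewrite [leRHS]big_mkcond; apply: ler_sum => i _.
    by rewrite x_AP; case: ifP => _; rewrite ?mul1r ?mul0r.
  + exact: y_ge0.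
- move=> i k; rewrite x_AP; case: andP => [[_ /eqP <-] _|_]; last by rewrite eqxx.
  by rewrite mulr_gt0.
- move=> i j k ir jr; rewrite x_relay// x_AP (anchor_relay jr) eqxx.
  have [aij|_] := eqVneq (anchor i) j; last by rewrite mul0r eqxx.
  have [<- _|_] := eqVneq (ap j) k; last by rewrite mulr0 eqxx.
  by rewrite -aij (ap_anchor asc) mulr_gt0.
Qed.
End Fixed.
End Association.

Theorem mainTheorem1 (d : measure_display) (Omega : measurableType d)
    (R : realType) (P : probability Omega R)
    (A C : finType) (relays : {set C})
    (L : C -> C + A -> link_model P)
    (eta : R) (eta_gt0 : 0 < eta) (eta_lt1 : eta < 1)
    (chat : C -> C + A -> R)
    (chatP : forall a b, is_link relays a b -> is_threshold (L a b) eta (chat a b))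
    (x : C -> C + A -> R)
    (x_feasible : exists (r : C -> R) (y : C -> A -> R),
       admissible relays L eta x r y) :
  exists rstar : C -> R,
    (forall r : C -> R,
       (exists y : C -> A -> R, optimal relays L eta x r y) <-> r = rstar) /\
    (forall i k, i \in ~: relays -> x i (inr k) = 1 ->
       rstar i = chat i (inr k)) /\
    (forall j k, j \in relays ->
       \sum_(i in ~: relays) x i (inl j) = 0 -> x j (inr k) = 1 ->
       rstar j = chat j (inr k)) /\
    (forall i j k, i \in ~: relays -> j \in relays ->
       x i (inl j) * x j (inr k) = 1 ->
       rstar i = Num.min (chat i (inl j)) (chat j (inr k) / 2) /\
       rstar j = chat j (inr k) - rstar i).
Proof.
have [r0 [y0 adm0]] := x_feasible.
have [anchor [ap asc]] := admissible_association adm0.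
pose lim i := chat i (inl (anchor i)); pose cap i := chat i (inr (ap i)).
pose rs := best_rate anchor lim cap.
have [rf0 sf0 chat0] := admissible_feasible asc chatP adm0.
have inj := anchor_inj asc; have aK := anchorK asc; have apK := ap_anchor asc.
have rsf : rate_feasible anchor lim cap rs := best_rate_feasible aK inj rf0.
pose ys := best_share R anchor ap.
have ysf : share_feasible anchor ap ys := best_share_feasible R aK apK.
have objE r y : admissible relays L eta x r y ->
    objective relays x r y = \sum_i ln (r i) + \sum_i ln (y i (ap i)).
  move=> /(admissible_feasible asc chatP)[[rp _ _] [yp _ _ _] _].
  rewrite (objectiveE asc) -big_split/=; apply: eq_bigr => i _.
  by rewrite lnM ?posrE.
have rate_le r : rate_feasible anchor lim cap r ->
    \sum_i ln (r i) <= \sum_i ln (rs i) ?= iff [forall i, r i == rs i].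
  move=> rf; apply: sum_ln_ratio; [exact: rate_gt0 rf|exact: rate_gt0 rsf|].
  exact: best_rate_ratio.
(* [rs] combines with any feasible shares, which decouples the two maximizations. *)
have adm_s y : share_feasible anchor ap y -> admissible relays L eta x rs y.
  by move=> sf; exact: (feasible_admissible asc chatP).
exists rs; split=> [r|]; first split.
- move=> [y [adm opt]]; have [rf sf _] := admissible_feasible asc chatP adm.
  (* Comparison with [rs] at the same shares [y] cancels the share terms; the equality case then
     forces [r = rs]. *)
  have := opt _ _ (adm_s _ sf); rewrite !objE// ?lerD2r; last exact: adm_s.
  move=> le; have [le' eq] := rate_le _ rf; apply: funext => i; apply/eqP.
  by move: i; apply/forallP; rewrite -eq eq_le le' le.
- move=> ->; exists ys; split=> [|r' y' adm']; first exact: adm_s.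
  have [rf sf _] := admissible_feasible asc chatP adm'.
  rewrite !objE//; last exact: adm_s.
  rewrite lerD// ?(rate_le _ rf)//.
  apply: sum_ln_ratio; [exact: share_gt0 sf|exact: share_gt0 ysf|].
  exact: best_share_ratio.
have AP1 i k : x i (inr k) = 1 -> anchor i = i /\ ap i = k.
  by rewrite (x_AP asc); case: andP => [[/eqP ? /eqP ?]//|_ /esym/eqP]; rewrite oner_eq0.
split=> [i k ir /AP1[ii <-]|].
  rewrite /rs /best_rate ii eqxx big_pred0 ?subr0// => m.
  rewrite (anchored_nonrelay asc)//; first by case: (m == i).
  by rewrite inE in ir.
split=> [j k jr x0 /AP1[jj <-]|i j k ir jr xx].
  rewrite /rs /best_rate jj eqxx; apply/eqP; rewrite subr_eq addrC -subr_eq subrr eq_sym.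
  have [-> //|[m [_ _ S]]] := relayed_sum R inj j.
  (* With unit rates, a relayed client [m] would make the zero load equal to [1]. *)
  have := anchored_client asc (fun=> 1) jr; under eq_bigr do rewrite mul1r.
  by rewrite x0 anchored_sum// S; lra.
have /eqP aij : anchor i == j.
  move: xx; rewrite (x_relay asc)//; case: eqP => // _ /esym/eqP.
  by rewrite mul0r oner_eq0.
have [jj apj] : anchor j = j /\ ap j = k.
  by apply: AP1; move: xx; rewrite (x_relay asc)// aij eqxx mul1r.
have ji : j != i by apply: contraTneq ir => <-; rewrite inE jr.
have rsi : rs i = relayed_rate anchor lim cap i.
  by rewrite /rs /best_rate aij (negbTE ji).
split; first by rewrite rsi /relayed_rate /lim /cap aij apj.
rewrite rsi /rs /best_rate jj eqxx /cap apj (big_pred1 i)// => m.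
apply/andP/eqP => [[/eqP mj nm]|->]; last by rewrite aij eq_sym.
by apply: inj; rewrite ?mj ?aij // eq_sym.
Qed.
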